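(* Let $(\mathbb{R}^m,\|\cdot\|)$ be a smooth Minkowski space, let $w$ be a concave weight function, and let $p_1,\dots,p_n\in\mathbb{R}^m$ (the sources) and $q\in\mathbb{R}^m$ (the single sink) be given points, all different from the origin $o$. Let $t_i>0$ be the flow associated with $p_i$. For each $i$ let $p_i^\ast$ denote the dual vector of $p_i$, and let $q^\ast$ denote the dual vector of $q$. Then the Gilbert arborescence with edges $op_i$, $i=1,\dots,n$, and $oq$, in which all flows are routed via the Steiner point $o$ (so that edge $op_i$ carries flow $t_i$ and edge $oq$ carries flow $\sum_{i=1}^n t_i$), is a minimum Gilbert arborescence for the sources $p_1,\dots,p_n$ with flows $t_1,\dots,t_n$, the sink $q$ and the weight function $w$, if and only if $$\sum_{i=1}^n w(t_i)\,p_i^\ast + w\Big(\sum_{i=1}^n t_i\Big)\,q^\ast = o$$ and $$\Big\|\sum_{i\in I} w(t_i)\,p_i^\ast\Big\|^\ast\leq w\Big(\sum_{i\in I} t_i\Big)\quad\text{for all } I\subseteq\{1,\dots,n\}.$$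
   Context: A Minkowski space is $\mathbb{R}^m$ endowed with a norm $\|\cdot\|$. It is smooth if the norm is differentiable at every $x\neq o$. Let $\langle\cdot,\cdot\rangle$ be the standard inner product. The dual norm is $\|z\|^\ast=\sup_{\|x\|\le 1}\langle z,x\rangle$. A dual vector of $x\ne o$ is a vector $x^\ast$ with $\langle x^\ast,x\rangle=\|x\|$ and $\|x^\ast\|^\ast=1$; in a smooth space it is unique and equals the gradient of the norm at $x$. A weight function is a function $w:[0,\infty)\to\mathbb{R}$ such that: $w(t)\ge 0$ for all $t$ and $w(t)>0$ if $t>0$; $w(t_1+t_2)\ge w(t_1)$ for all $t_2>0$; $w(t_1+t_2)\le w(t_1)+w(t_2)$ for all $t_1,t_2>0$. Here it is moreover assumed to be concave. Given a set of terminals $\{p_1,\dots,p_n,q\}$ in a Minkowski space, where $p_1,\dots,p_n$ are sources with positive flows $t_1,\dots,t_n$ and $q$ is the sink, a Gilbert arborescence is a tree (with straight edges) whose vertices are the terminals together with finitely many (possibly zero) additional points, called Steiner points, at arbitrary locations. The flow $t_i$ is routed from $p_i$ to $q$ along the unique path in the tree from $p_i$ to $q$. The total flow $t_e$ on an edge $e$ is the sum of the $t_i$ over all $i$ such that the path from $p_i$ to $q$ uses $e$. The cost of an edge $e=xy$ is $w(t_e)\|x-y\|$, and the cost of the arborescence is the sum of the costs of its edges. A minimum (minimal) Gilbert arborescence is a Gilbert arborescence of globally minimum cost among all Gilbert arborescences for the same terminals, flows and weight function (the number, location and adjacency of Steiner points being free). *)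

(* Defs.v *)
From mathcomp Require Import all_boot all_order all_algebra.
From mathcomp Require Import all_classical all_reals all_analysis.

Set Implicit Arguments.
Unset Strict Implicit.
Unset Printing Implicit Defensive.

Import Order.TTheory GRing.Theory Num.Theory.
Import numFieldNormedType.Exports.

Local Open Scope classical_set_scope.
Local Open Scope ring_scope.

(** * Minkowski spaces *)

Definition dot (R : realType) (m : nat) (u v : 'rV[R]_m) : R :=
  \sum_(j < m) u 0 j * v 0 j.

Record is_norm (R : realType) (m : nat) (N : 'rV[R]_m -> R) : Prop := IsNorm {
  is_norm_triangle : forall x y, N (x + y) <= N x + N y;
  is_norm_scale : forall (a : R) x, N (a *: x) = `|a| * N x;
  is_norm_eq0 : forall x, N x = 0 -> x = 0 }.

(* [differentiable] refers to the canonical (sup-norm) topology of ['rV[R]_m];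
   all norms on R^m give the same notion. *)
Definition smooth_norm (R : realType) (m : nat) (N : 'rV[R]_m -> R) : Prop :=
  forall x : 'rV[R]_m, x != 0 -> differentiable N x.

Definition dual_norm (R : realType) (m : nat) (N : 'rV[R]_m -> R)
    (z : 'rV[R]_m) : R :=
  sup [set dot z x | x in [set x : 'rV[R]_m | N x <= 1]].

Definition is_dual_vector (R : realType) (m : nat) (N : 'rV[R]_m -> R)
    (x xs : 'rV[R]_m) : Prop :=
  dot xs x = N x /\ dual_norm N xs = 1.

(** * Weight functions *)

(* Only the values of [w] on [0, +oo[ matter. *)
Record weight_function (R : realType) (w : R -> R) : Prop := WeightFunction {
  weight_ge0 : forall t, 0 <= t -> 0 <= w t;
  weight_gt0 : forall t, 0 < t -> 0 < w t;
  weight_nondecreasing :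
    forall t1 t2, 0 <= t1 -> 0 < t2 -> w t1 <= w (t1 + t2);
  weight_subadditive :
    forall t1 t2, 0 < t1 -> 0 < t2 -> w (t1 + t2) <= w t1 + w t2 }.

Definition concave_weight (R : realType) (w : R -> R) : Prop :=
  convex_function (`[0, +oo[ : set (convex_lmodType R^o)) (fun t => - w t).

(** * Trees *)

Section Trees.
Variables (V : finType) (e : rel V).

(* Cycles of a simple graph have at least three vertices: a two-vertex [ucycle]
   goes back and forth along one edge. *)
Definition is_tree : Prop :=
  [/\ symmetric e,
      irreflexive e,
      forall x y, connect e x y
    & forall c : seq V, ucycle e c -> (size c <= 2)%N].

Definition simple_path (x y : V) (s : seq V) : bool :=
  [&& path e x s, last x s == y & uniq (x :: s)].

(* The edge {a, b} is traversed, in either direction, by the walk [x :: s]. *)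
Definition traverses (x : V) (s : seq V) (a b : V) : bool :=
  ((a, b) \in zip (x :: s) s) || ((b, a) \in zip (x :: s) s).

(* In a tree the simple path from [x] to [y] is unique. *)
Definition path_uses (x y a b : V) : bool :=
  `[< exists s : seq V, simple_path x y s /\ traverses x s a b >].

End Trees.

(** * Gilbert arborescences *)

(* Vertices are labelled: [inl (Some i)] is the i-th source, [inl None] the
   sink, [inr j] the j-th Steiner point. Distinct vertices may have the same
   location. *)
Definition vertex (n k : nat) : finType := (option 'I_n + 'I_k)%type.

Definition source (n k : nat) (i : 'I_n) : vertex n k := inl (Some i).
Definition sink (n k : nat) : vertex n k := inl None.

Record gilbert_graph (R : realType) (m n : nat) := GilbertGraph {
  nsteiner : nat;
  steiner : 'I_nsteiner -> 'rV[R]_m;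
  adj : rel (vertex n nsteiner) }.

Section Cost.
Variables (R : realType) (m n : nat).
Variables (N : 'rV[R]_m -> R) (w : R -> R).
Variables (p : 'I_n -> 'rV[R]_m) (q : 'rV[R]_m) (t : 'I_n -> R).

Definition location (G : gilbert_graph R m n) (v : vertex n (nsteiner G)) :
    'rV[R]_m :=
  match v with
  | inl (Some i) => p i
  | inl None => q
  | inr j => steiner j
  end.

Definition is_arborescence (G : gilbert_graph R m n) : Prop :=
  is_tree (adj (g := G)).

Definition edge_flow (G : gilbert_graph R m n) (a b : vertex n (nsteiner G)) :
    R :=
  \sum_(i < n | path_uses (adj (g := G)) (source _ i) (sink _ _) a b) t i.

Definition edge_cost (G : gilbert_graph R m n) (a b : vertex n (nsteiner G)) :
    R :=
  w (edge_flow a b) * N (location a - location b).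

(* The comparison of ranks selects one orientation of every edge. *)
Definition cost (G : gilbert_graph R m n) : R :=
  \sum_(a : vertex n (nsteiner G))
    \sum_(b | adj a b && (enum_rank a < enum_rank b)%N) edge_cost a b.

Definition minimum_arborescence (G : gilbert_graph R m n) : Prop :=
  is_arborescence G /\
  forall G' : gilbert_graph R m n, is_arborescence G' -> cost G <= cost G'.

End Cost.

(* One Steiner point, located at the origin and joined to every terminal. *)
Definition star (R : realType) (m n : nat) : gilbert_graph R m n :=
  @GilbertGraph R m n 1 (fun _ => 0)
    (fun a b => match a, b with
                | inl _, inr _ | inr _, inl _ => true
                | _, _ => false
                end).

(* Main.v *)
Require Import Defs.
From mathcomp Require Import all_boot all_order all_algebra.
From mathcomp Require Import all_classical all_reals all_analysis.
Import Order.TTheory GRing.Theory Num.Theory.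
Import numFieldNormedType.Exports.
Local Open Scope ring_scope.

(** If the balance and dual norm conditions hold, the star costs
    [\sum_i w (t i) * <p_i^*, p_i - q>]. Splitting each [p_i - q] along the path
    from [p_i] to [q] in any competing tree, and summing over the edges [e]
    first, turns this into a sum of [<\sum_(i through e) w (t i) p_i^*, e>],
    each term being at most the cost of [e].

    Conversely, moving the Steiner point of an optimal star in a direction [-v]
    shows that the linear form [<\sum_i w (t i) p_i^* + w (\sum_i t i) q^*, v>]
    is nonnegative, hence zero. Detaching the sources in [I] from [o] and
    attaching them to a new Steiner point [h x], itself joined to [o], changes
    the cost at first order by
    [h (w (\sum_(i in I) t i) * N x - <\sum_(i in I) w (t i) p_i^*, x>)],
    which gives the dual norm bound. *)

Set Implicit Arguments.
Unset Strict Implicit.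
Unset Printing Implicit Defensive.

(** * Uniqueness of simple paths in an acyclic graph *)

Section SimplePaths.
Variables (V : finType) (e : rel V).

(* From the first vertex [x] after which two paths differ, their remainders join
   the two successors of [x] while avoiding [x], which closes a cycle. *)
Lemma acyclic_simple_path_uniq (e_sym : symmetric e)
    (e_acyclic : forall c : seq V, ucycle e c -> (size c <= 2)%N)
    (x y : V) (s1 s2 : seq V) :
  simple_path e x y s1 -> simple_path e x y s2 -> s1 = s2.
Proof.
elim: s1 x s2 => [|a s1 IH] x [|b s2] //.
- move=> /and3P[_ /eqP <- _] /and3P[_ /eqP /= xE /andP[+ _]].
  by rewrite -[x in x \notin _]xE mem_last.
- move=> /and3P[_ /eqP /= + /andP[xN _]] /and3P[_ /eqP /= yE _].
  by rewrite -yE => xE; move: xN; rewrite -[x in x \notin _]xE mem_last.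
move=> /and3P[/= /andP[exa ps1] /eqP l1 /andP[x1 u1]].
move=> /and3P[/= /andP[exb ps2] /eqP l2 /andP[x2 u2]].
have [eab|nab] := eqVneq a b.
  rewrite -eab in ps2 l2 u2 *; congr cons; apply: (IH a).
    by apply/and3P; split=> //; rewrite l1.
  by apply/and3P; split=> //; rewrite l2.
pose ex := [rel u v | [&& e u v, u != x & v != x]].
have exs : symmetric ex by move=> u v /=; rewrite e_sym [(u != x) && _]andbC.
have liftp (c : V) s : path e c s -> x \notin c :: s -> path ex c s.
  elim: s c => //= d s IHs c /andP[ecd ps].
  rewrite !inE !negb_or => /and3P[xc xd xs].
  by rewrite ecd eq_sym xc eq_sym xd IHs// inE negb_or xd.
have cay : connect ex a y by apply/connectP; exists s1; rewrite ?l1 ?liftp.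
have cby : connect ex b y by apply/connectP; exists s2; rewrite ?l2 ?liftp.
have : connect ex a b.
  by apply: connect_trans cay _; rewrite (sym_connect_sym exs).
case/connectP => s0 ps0 bE; case/shortenP: ps0 bE => s ps us _ bE.
have xas : x \notin a :: s.
  rewrite inE negb_or; apply/andP; split.
    by apply: contraNneq x1 => ->; rewrite inE eqxx.
  elim: s {us bE} a ps {x1 u1 l1 exa nab ps1 cay} => //= c s IHs a.
  move=> /andP[/and3P[_ _ cx] pcs]; rewrite inE negb_or eq_sym cx.
  exact: IHs pcs.
have /e_acyclic : ucycle e (x :: a :: s).
  rewrite /ucycle /cycle /= rcons_path exa -bE e_sym exb andbT.
  move: us => /= /andP[-> ->]; rewrite andbT xas andbT.
  rewrite andbT.
  by apply: sub_path ps => u v /= /and3P[].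
(* The cycle can have at most two vertices only if [s] is empty, and then [b], the last vertex of
   [a :: s], equals [a]. *)
by case: s bE {us ps xas} => // ba; rewrite ba eqxx in nab.
Qed.

Lemma traversesC (x : V) s a b : traverses x s a b = traverses x s b a.
Proof. by rewrite /traverses orbC. Qed.

Lemma path_usesC (x y a b : V) : path_uses e x y a b = path_uses e x y b a.
Proof.
by apply/asboolP/asboolP => -[s [sp st]]; exists s; rewrite traversesC.
Qed.

End SimplePaths.

(** * Trees described by a parent map towards a root *)

Section RootedTrees.
Variable V : finType.

(** The map [par] orients all edges towards [r], so that edges correspond to the vertices other than
    [r]. The rank [depth] need not be a distance: its strict decrease only serves induction and
    excludes cycles. *)
Record rooted (e : rel V) (r : V) (par : V -> V) (depth : V -> nat) : Prop :=
  Rooted {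
    rooted_root : par r = r;
    rooted_depth : forall v, v != r -> (depth (par v) < depth v)%N;
    rooted_edge : forall a b,
      e a b = (a != r) && (b == par a) || (b != r) && (a == par b) }.

(** With [P v] the unique simple path from [v] to [r], the parent of [v] is the first vertex of
    [P v] and its depth the length of [P v]. *)
Lemma tree_rooted (e : rel V) (r : V) :
  is_tree e -> exists par depth, rooted e r par depth.
Proof.
move=> [e_sym e_irr e_conn e_acyc].
have U := acyclic_simple_path_uniq e_sym e_acyc.
have /choice[P PP] : forall v, exists s, simple_path e v r s.
  move=> v; have /connectP[s0 ps0 rE] := e_conn v r.
  by case/shortenP: ps0 rE => s ps us _ rE; exists s;
    rewrite /simple_path ps us -rE eqxx.
have Pcons v y s : P v = y :: s -> P y = s.
  move=> Pv; have := PP v; rewrite Pv => /and3P[/= /andP[_ ps] lr /andP[_ us]].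
  by apply: (U y r) => //; apply/and3P.
have Pedge a b : e a b -> P a = b :: P b \/ P b = a :: P a.
  move=> eab; have /and3P[pb lb ub] := PP b.
  have [aPb|aPb] := boolP (a \in b :: P b); last first.
    by left; apply: (U a r) => //; apply/and3P; split; rewrite /= ?eab ?aPb.
  right; have {}aPb : a \in P b.
    by move: aPb; rewrite inE => /predU1P[ab|//]; rewrite ab e_irr in eab.
  have [s1 [s2 PbE]] : exists s1 s2, P b = s1 ++ a :: s2.
    by case/splitPr: aPb => s1 s2; exists s1, s2.
  rewrite PbE in pb ub.
  (* The part of [P b] up to [a] and the single edge from [b] to [a] are both simple paths, hence
     equal. *)
  have : rcons s1 a = [:: a].
    apply: (U b a); apply/and3P; split; rewrite ?last_rcons //=.
    + by move: pb; rewrite -cat_rcons cat_path => /andP[].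
    + by move: ub; rewrite -cat_rcons -cat_cons cat_uniq => /and3P[].
    + by rewrite e_sym eab.
    + by rewrite inE andbT; apply: contraTneq eab => ->; rewrite e_irr.
  case: s1 PbE {pb ub} => [|? []] // PbE _.
  by rewrite PbE (Pcons _ _ _ PbE).
have Pr : P r = [::] by apply: (U r r); rewrite // /simple_path /= eqxx.
have PN v : v != r -> P v = head r (P v) :: P (head r (P v)).
  move=> vr; case PE : (P v) => [|y s] /=; last by rewrite (Pcons _ _ _ PE).
  by have := PP v; rewrite PE => /and3P[_ /eqP /= vE]; rewrite vE eqxx in vr.
(* Since [P r] is empty, the default value of [head] makes [r] its own parent. *)
exists (fun v => head r (P v)), (size \o P); split => [|v vr|a b] /=.
- by rewrite Pr.
- by rewrite [X in (_ < size X)%N]PN.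
have e_head v : v != r -> e v (head r (P v)).
  by move=> vr; have := PP v; rewrite PN//= => /and3P[/andP[]].
apply/idP/orP => [eab|[/andP[ar /eqP->]|/andP[br /eqP->]]].
- case: (Pedge _ _ eab) => PE; [left|right]; rewrite PE eqxx andbT.
    by apply: contra_eq_neq PE => ->; rewrite Pr.
  by apply: contra_eq_neq PE => ->; rewrite Pr.
- exact: e_head.
- by rewrite e_sym; exact: e_head.
Qed.

Section Theory.
Variables (e : rel V) (r : V) (par : V -> V) (depth : V -> nat).
Hypothesis e_rooted : rooted e r par depth.

Let par_root := rooted_root e_rooted.
Let par_depth := rooted_depth e_rooted.
Let eE := rooted_edge e_rooted.

Lemma rooted_ind (P : V -> Prop) :
  P r -> (forall v, v != r -> P (par v) -> P v) -> forall v, P v.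
Proof.
move=> Pr Pv v; have [k] := ubnP (depth v); elim: k v => // k IH v.
rewrite ltnS => dv; have [->//|vr] := eqVneq v r.
by apply: (Pv) => //; apply: IH; apply: leq_trans dv; exact: par_depth.
Qed.

Lemma rooted_sym : symmetric e.
Proof. by move=> a b; rewrite !eE orbC. Qed.

(* The deepest vertex of a cycle would have its parent as both neighbours. *)
Lemma rooted_tree : is_tree e.
Proof.
split=> [|x|x y|c].
- exact: rooted_sym.
- rewrite eE orbb; apply/negP => /andP[/par_depth + /eqP xE].
  by rewrite -xE ltnn.
- have cr v : connect e v r.
    elim/rooted_ind: v => [//|v vr]; apply: connect_trans.
    by apply: connect1; rewrite eE vr eqxx.
  apply: connect_trans (cr x) _.
  by rewrite (sym_connect_sym rooted_sym).
move=> /andP[ec uc]; rewrite leqNgt; apply/negP => sc.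
have [x0 x0c] : exists x, x \in c.
  by case: c sc {ec uc} => // x c _; exists x; rewrite inE eqxx.
case: (@arg_maxnP _ x0 (mem c) depth x0c) => v vc vmax.
have up u : u \in c -> e v u -> u = par v.
  move=> uc'; rewrite eE => /orP[/andP[_ /eqP//]|/andP[ur /eqP vE]].
  by have := vmax u uc'; rewrite /= vE leqNgt par_depth.
(* Rotated to start at [v], the cycle has the neighbours of [v] as its second and last vertices,
   which are distinct because there are more than two vertices. *)
have := vc => /rot_to[i c' c'E].
have mc : rot i c =i c := mem_rot i c.
move: ec uc sc; rewrite -(rot_cycle i) -(rot_uniq i) -(size_rot i) c'E.
rewrite c'E in mc.
case: c' {c'E} mc => [|a c'] // mc; case/lastP: c' mc => [|c' b] // mc.
rewrite /cycle rcons_path /= last_rcons => /andP[/andP[eva _] ebv] ua _.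
have aE : a = par v by apply: up => //; rewrite -mc !inE eqxx orbT.
have bE : b = par v.
  by apply: up; rewrite 1?rooted_sym// -mc !inE mem_rcons inE eqxx !orbT.
by move: ua; rewrite aE bE mem_rcons inE eqxx /= andbF.
Qed.

(** [fconnect par x a] expresses that [a] is [x] or one of its ancestors. *)
Lemma fconnect_unfold (x a : V) :
  fconnect par x a = (a == x) || fconnect par (par x) a.
Proof.
apply/idP/predU1P => [|[->|]]; last 2 first.
- exact: connect0.
- by apply: connect_trans; exact: fconnect1.
move/connectP => [[|y s] /=]; first by move=> _ ->; left.
by move=> /andP[/eqP <- ps] aE; right; apply/connectP; exists s.
Qed.

Lemma fconnect_root (a : V) : a != r -> fconnect par r a = false.
Proof.
move=> ar; apply/negP => /iter_findex; rewrite iter_fix // => rE.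
by rewrite rE eqxx in ar.
Qed.

Lemma fconnect_depth (x a : V) : fconnect par x a -> (depth a <= depth x)%N.
Proof.
elim/rooted_ind: x => [|x xr IH].
  by have [->//|/fconnect_root ->] := eqVneq a r.
rewrite fconnect_unfold => /predU1P[->//|/IH dax].
exact: leq_trans dax (ltnW (par_depth xr)).
Qed.

(** The path is the chain of ancestors of [x]. The depth bound is carried through the induction to
    keep [x] off the rest of the chain, so that the path stays simple. *)
Lemma rooted_simple_path (x : V) : exists s : seq V,
  [/\ simple_path e x r s, {in s, forall z, (depth z < depth x)%N} &
    forall a, a != r -> traverses x s a (par a) = fconnect par x a].
Proof.
elim/rooted_ind: x => [|x xr [s [/and3P[ps ls us] ds ts]]].
  exists [::]; split => // [|a ar]; first by rewrite /simple_path /= eqxx.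
  by rewrite fconnect_root.
have d' : {in par x :: s, forall z, (depth z < depth x)%N}.
  move=> z; rewrite inE => /predU1P[->|/ds]; first exact: par_depth.
  by move=> /ltn_trans; apply; exact: par_depth.
exists (par x :: s); split=> // [|a ar].
  apply/and3P; split=> //=; first by rewrite eE xr eqxx.
  move: us => /= ->; rewrite andbT.
  by apply/negP => /d'; rewrite ltnn.
rewrite fconnect_unfold -ts// /traverses /= !inE !xpair_eqE.
have -> : (par a == x) && (a == par x) = false.
  apply/negP => /andP[/eqP pa /eqP ap]; have := par_depth ar.
  by rewrite pa ap ltnNge ltnW// par_depth.
have -> : (a == x) && (par a == par x) = (a == x).
  by apply/andb_idr => /eqP ->.
by rewrite orFb orbA.
Qed.

Lemma rooted_path_uses (x a : V) :
  a != r -> path_uses e x r a (par a) = fconnect par x a.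
Proof.
move=> ar; have [s [ss _ /(_ a ar) <-]] := rooted_simple_path x.
apply/asboolP/idP => [[s' [ss']]|]; last by exists s.
have [e_sym _ _ acyc] := rooted_tree.
by rewrite (acyclic_simple_path_uniq e_sym acyc ss ss').
Qed.

(** Peeling off the edge from [x] to its parent leaves the sum for [par x], since by depth [x] is
    not an ancestor of its own parent. *)
Lemma rooted_telescope (M : zmodType) (f : V -> M) (x : V) :
  \sum_(a | (a != r) && fconnect par x a) (f a - f (par a)) = f x - f r.
Proof.
elim/rooted_ind: x => [|x xr IH].
  rewrite big_pred0 ?subrr// => a.
  by apply/negP => /andP[/fconnect_root ->].
rewrite (bigD1 x) ?xr ?connect0//= -[RHS](subrKA (f (par x))) -IH.
congr (_ + _); apply: eq_bigl => a; rewrite (fconnect_unfold x) -andbA.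
have [->|ax] := eqVneq a x; rewrite /= ?andbT ?andbF//.
rewrite xr /=; apply/esym/negP => /fconnect_depth.
by rewrite leqNgt par_depth.
Qed.

(** Each edge has exactly one end whose parent is the other end, so that child can index it instead
    of the orientation by ranks. *)
Lemma rooted_edge_sum (R : nmodType) (F : V -> V -> R) :
  (forall a b, F a b = F b a) ->
  \sum_a \sum_(b | e a b && (enum_rank a < enum_rank b)%N) F a b =
  \sum_(a | a != r) F a (par a).
Proof.
move=> Fsym; pose A a b := (a != r) && (b == par a).
(* The sum is split by which end is the child. Exchanging the indices in the second half makes [a]
   the child in both, and the two rank conditions then complement each other. *)
transitivity (\sum_a \sum_b
   ((if A a b && (enum_rank a < enum_rank b)%N then F a b else 0) +
    (if A b a && (enum_rank a < enum_rank b)%N then F b a else 0))).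
  apply: eq_bigr => a _; rewrite big_mkcond; apply: eq_bigr => b _.
  rewrite eE -/(A a b) -/(A b a) [F b a]Fsym.
  have [|_] := ltnP (enum_rank a) _; last by rewrite !andbF addr0.
  rewrite !andbT; have [Aab|] := boolP (A a b); last by rewrite add0r.
  rewrite ifF ?addr0//; apply/negP => Aba.
  move: Aab Aba => /andP[ar /eqP bE] /andP[br /eqP aE].
  by have := par_depth ar; rewrite -bE ltnNge ltnW// aE par_depth.
under eq_bigr do rewrite big_split.
rewrite big_split /= [X in _ + X]exchange_big -big_split [RHS]big_mkcond /=.
apply: eq_bigr => a _; rewrite -big_split /= (bigD1 (par a)) //= big1 ?addr0.
  rewrite /A eqxx andbT; have [//|ar] := eqVneq a r; first by rewrite addr0.
  case: ltngtP => [||/val_inj/enum_rank_inj aE]; rewrite ?addr0 ?add0r//.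
  by have := par_depth ar; rewrite -aE ltnn.
by move=> b ba; rewrite /A (negPf ba) andbF addr0.
Qed.

End Theory.
End RootedTrees.

Lemma sum_option (M : nmodType) (T : finType) (F : option T -> M) :
  \sum_x F x = F None + \sum_x F (Some x).
Proof.
rewrite (bigD1 None)//=; congr (_ + _).
rewrite (reindex_omap Some id) => [|[]//].
by apply: eq_bigl => x; rewrite eqxx.
Qed.

(** * Bilinearity of the standard inner product *)

Section Dot.
Variables (R : realType) (m : nat).
Implicit Types u v x : 'rV[R]_m.

Lemma dotDl u v x : dot (u + v) x = dot u x + dot v x.
Proof.
by rewrite -big_split; apply: eq_bigr => j _; rewrite mxE mulrDl.
Qed.

Lemma dotZl a u x : dot (a *: u) x = a * dot u x.
Proof. by rewrite mulr_sumr; apply: eq_bigr => j _; rewrite mxE mulrA. Qed.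

Lemma dotC u v : dot u v = dot v u.
Proof. by apply: eq_bigr => j _; rewrite mulrC. Qed.

Lemma dotDr u v x : dot x (u + v) = dot x u + dot x v.
Proof. by rewrite !(dotC x) dotDl. Qed.

Lemma dotZr a u x : dot x (a *: u) = a * dot x u.
Proof. by rewrite !(dotC x) dotZl. Qed.

Lemma dotNr u x : dot x (- u) = - dot x u.
Proof. by rewrite -scaleN1r dotZr mulN1r. Qed.

Lemma dot0l x : dot 0 x = 0.
Proof. by rewrite -(scale0r x) dotZl mul0r. Qed.

Lemma dot0r x : dot x 0 = 0.
Proof. by rewrite dotC dot0l. Qed.

Lemma dot_suml (I : Type) (r : seq I) (P : pred I) (F : I -> 'rV[R]_m) x :
  dot (\sum_(i <- r | P i) F i) x = \sum_(i <- r | P i) dot (F i) x.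
Proof.
exact: (big_morph (fun u => dot u x) (fun u v => dotDl u v x) (dot0l x)).
Qed.

Lemma dot_sumr (I : Type) (r : seq I) (P : pred I) (F : I -> 'rV[R]_m) x :
  dot x (\sum_(i <- r | P i) F i) = \sum_(i <- r | P i) dot x (F i).
Proof. by rewrite dotC dot_suml; apply: eq_bigr => i _; rewrite dotC. Qed.

(** Testing with [- u] forces [dot u u] to vanish. *)
Lemma dot_ge0_eq0 u : (forall v, 0 <= dot u v) -> u = 0.
Proof.
move=> u0; have uu : dot u u = 0.
  apply/eqP; rewrite eq_le u0 andbT -oppr_ge0.
  by rewrite -mulN1r -dotZr.
apply/rowP => j; rewrite mxE; apply/eqP; rewrite -sqrf_eq0 expr2.
have /psumr_eq0P : dot u u = 0 by [].
by move=> -> // i _; rewrite -expr2 sqr_ge0.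
Qed.

End Dot.

(** * Dual norm, dual vectors and first variations *)

Section DualNorm.
Variables (R : realType) (m : nat) (N : 'rV[R]_m -> R).
Hypothesis hN : is_norm N.

Lemma norm0 : N 0 = 0.
Proof. by rewrite -(scale0r 0) (is_norm_scale hN) normr0 mul0r. Qed.

Lemma normN x : N (- x) = N x.
Proof. by rewrite -scaleN1r (is_norm_scale hN) normrN normr1 mul1r. Qed.

Lemma norm_ge0 x : 0 <= N x.
Proof.
have := is_norm_triangle hN x (- x).
by rewrite subrr norm0 normN -mulr2n pmulrn_lge0.
Qed.

Lemma dot_le_norm z c : 0 <= c -> (forall x, N x <= 1 -> dot z x <= c) ->
  forall x, dot z x <= c * N x.
Proof.
move=> c0 zc x; have [x0|x0] := eqVneq (N x) 0.
  by rewrite (is_norm_eq0 hN x0) dot0r norm0 mulr0.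
have Nx : 0 < N x by rewrite lt_neqAle eq_sym x0 norm_ge0.
rewrite -ler_pdivrMr// mulrC -dotZr zc// (is_norm_scale hN).
by rewrite ger0_norm ?invr_ge0 ?norm_ge0// mulVf.
Qed.

Lemma dual_norm_dot_le z c : dual_norm N z <= c ->
  has_ubound [set dot z x | x in [set x | N x <= 1]] ->
  forall x, dot z x <= c * N x.
Proof.
move=> zc zb; have ub x : N x <= 1 -> dot z x <= c.
  by move=> Nx; apply: le_trans zc; apply: ub_le_sup => //; exists x.
by apply: dot_le_norm => //; rewrite -(dot0r z) ub// norm0.
Qed.

Lemma dual_norm_le z c : (forall x, N x <= 1 -> dot z x <= c) ->
  dual_norm N z <= c.
Proof.
move=> zc; apply: ge_sup; first by exists (dot z 0), 0; rewrite //= norm0.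
by move=> _ [x Nx <-]; exact: zc.
Qed.

(* [sup] is [0] on unbounded sets, so a nonzero dual norm is a true supremum. *)
Lemma dual_vector_dot_le x xs : is_dual_vector N x xs ->
  forall y, dot xs y <= N y.
Proof.
move=> [_ xs1] y; rewrite -[N y]mul1r.
apply: dual_norm_dot_le; first by rewrite xs1.
apply: contrapT => nb; have : dual_norm N xs = 0.
  by apply: sup_out => -[].
by rewrite xs1 => /eqP; rewrite oner_eq0.
Qed.

(** The dual vector is a subgradient: [dot xs v] bounds the difference quotients from below for
    [h > 0] and from above for [h < 0]. Differentiability gives both sides the same limit. *)
Lemma dual_vector_derivative x xs v :
  is_dual_vector N x xs -> differentiable N x ->
  ((fun h => h^-1 * (N (x + h *: v) - N x)) @ 0^'+ --> dot xs v)%classic.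
Proof.
move=> hxs /(@diff_derivable _ _ _ N x v) dN.
pose f h := h^-1 * (N (x + h *: v) - N x).
have fE : f = (fun h => h^-1 *: ((N \o shift x) (h *: v) - N x)).
  by apply/funext => h /=; rewrite [_ *: v + x]addrC.
have /cvg_ex[/= l fl] : cvg (f h @[h --> 0^'])%classic by rewrite fE.
have sub h : h * dot xs v <= N (x + h *: v) - N x.
  rewrite lerBrDl -(proj1 hxs) -dotZr -dotDr.
  exact: dual_vector_dot_le hxs _.
suff -> : dot xs v = l by apply: cvg_dnbhs_at_right.
apply/eqP; rewrite eq_le; apply/andP; split.
  apply: (cvgr_to_ge (cvg_dnbhs_at_right fl)).
  near=> h; have h0 : 0 < h by near: h; exact: nbhs_right_gt.
  by rewrite ler_pdivlMl.
apply: (cvgr_to_le (cvg_dnbhs_at_left fl)).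
near=> h; have h0 : h < 0 by near: h; exact: nbhs_left_lt.
by rewrite ler_ndivrMl.
Unshelve. all: by end_near. Qed.

(** The assumed inequality is divided by [h], which then tends to [0] from the right. The term [b]
    leaves room for a bound on the cost of a new edge, linear in [h]. *)
Lemma first_variation_ge0 (J : finType) (c : J -> R) (p ps v : J -> 'rV[R]_m)
    (b : R) :
  (forall j, is_dual_vector N (p j) (ps j)) ->
  (forall j, differentiable N (p j)) ->
  (forall h, 0 < h ->
     0 <= \sum_j c j * (N (p j + h *: v j) - N (p j)) + h * b) ->
  0 <= \sum_j c j * dot (ps j) (v j) + b.
Proof.
move=> dp Dp F0.
pose f j h := h^-1 * (N (p j + h *: v j) - N (p j)).
have lim_f : ((fun h => \sum_j c j * f j h + b) @ 0^'+ -->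
    \sum_j c j * dot (ps j) (v j) + b)%classic.
  apply: cvgD; last exact: cvg_cst.
  apply: cvg_big => [|j _]; first exact: add_continuous.
  apply: cvgMr; exact: dual_vector_derivative.
apply: (cvgr_to_ge lim_f); near=> h.
have h0 : 0 < h by near: h; exact: nbhs_right_gt.
rewrite -(pmulr_rge0 _ h0) mulrDr mulr_sumr.
under eq_bigr do rewrite /f mulrCA mulVKf ?gt_eqF//.
exact: F0.
Unshelve. all: by end_near. Qed.

End DualNorm.

(** * Costs of rooted arborescences, hubs and the star *)

Section Cost.
Variables (R : realType) (m n : nat).
Variables (N : 'rV[R]_m -> R) (w : R -> R).
Variables (p : 'I_n -> 'rV[R]_m) (q : 'rV[R]_m) (t : 'I_n -> R).

(** The flow on the edge from [a] to its parent comes from the sources that have [a] as an ancestor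
    or are [a] itself. *)
Lemma rooted_cost (G : gilbert_graph R m n)
    (par : vertex n (nsteiner G) -> vertex n (nsteiner G)) depth :
  is_norm N ->
  rooted (adj (g := G)) (sink n (nsteiner G)) par depth ->
  cost N w p q t G =
  \sum_(a | a != sink n (nsteiner G))
    w (\sum_(i < n | fconnect par (source (nsteiner G) i) a) t i) *
    N (location p q a - location p q (par a)).
Proof.
move=> hN rG; rewrite /cost (rooted_edge_sum rG) => [|a b].
  apply: eq_bigr => a ar; congr (w _ * _).
  by apply: eq_bigl => i; exact: (rooted_path_uses rG).
rewrite /edge_cost -opprB (normN hN); congr (w _ * _).
by apply: eq_bigl => i; exact: path_usesC.
Qed.

Variables (k : nat) (g : 'I_n -> 'I_k.+1).

(* Source [i] is attached to the Steiner point [g i], the Steiner point [0] to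
   the sink, the other Steiner points to the Steiner point [0]. *)
Definition hub_parent (a : vertex n k.+1) : vertex n k.+1 :=
  match a with
  | inl (Some i) => inr (g i)
  | inl None => inl None
  | inr j => if j == ord0 then inl None else inr ord0
  end.

Definition hub_depth (a : vertex n k.+1) : nat :=
  match a with
  | inl (Some _) => 3
  | inl None => 0
  | inr j => if j == ord0 then 1 else 2
  end.

Definition hub_adj (a b : vertex n k.+1) : bool :=
  (a != sink n k.+1) && (b == hub_parent a)
  || (b != sink n k.+1) && (a == hub_parent b).

Lemma hub_rooted : rooted hub_adj (sink n k.+1) hub_parent hub_depth.
Proof.
split=> // -[[i|]|j] //= _; first by case: ifP.
by have [//|/negPf j0] := eqVneq j ord0.
Qed.

Lemma hub_fconnect (i : 'I_n) (a : vertex n k.+1) : a != sink n k.+1 ->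
  fconnect hub_parent (source k.+1 i) a =
  [|| a == source k.+1 i, a == inr (g i) | a == inr ord0].
Proof.
move=> ar; rewrite 2!fconnect_unfold /=; congr (_ || _).
have [->|_] := eqVneq (g i) ord0.
  by rewrite (fconnect_root hub_rooted) ?orbF ?orbb.
by rewrite fconnect_unfold /= (fconnect_root hub_rooted) ?orbF.
Qed.

(** The adjacency [e] is left general so that the formula covers [star] as well as [hub_adj]. *)
Lemma hub_cost (s : 'I_k.+1 -> 'rV[R]_m) (e : rel (vertex n k.+1)) :
  is_norm N -> rooted e (sink n k.+1) hub_parent hub_depth ->
  cost N w p q t (GilbertGraph s e) =
  \sum_i w (t i) * N (p i - s (g i)) +
  (w (\sum_i t i) * N (s ord0 - q) +
   \sum_(j < k) w (\sum_(i | g i == lift ord0 j) t i) *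
                N (s (lift ord0 j) - s ord0)).
Proof.
move=> hN re; rewrite (@rooted_cost (GilbertGraph s e) _ _ hN re) /=.
rewrite big_sumType /= big_mkcond sum_option /= add0r big_ord_recl /=.
congr (_ + (w _ * _ + _)).
- apply: eq_bigr => i _; congr (w _ * _); apply: big_pred1 => j.
  by rewrite hub_fconnect//= orbF [LHS]eq_sym.
- by apply: eq_bigl => i; rewrite hub_fconnect//= eqxx orbT.
- apply: eq_bigr => j _; congr (w _ * _); apply: eq_bigl => i.
  by rewrite hub_fconnect//= orbF [LHS]eq_sym.
Qed.

End Cost.

Lemma star_rooted (R : realType) (m n : nat) :
  rooted (adj (g := star R m n)) (sink n 1)
    (hub_parent (fun _ : 'I_n => ord0)) (@hub_depth n 0).
Proof.
split=> [//||[[i|]|j] [[i'|]|j']]; rewrite ?(ord1 j) ?(ord1 j')//.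
by move=> [[i|]|j]//; rewrite (ord1 j).
Qed.

Lemma star_cost (R : realType) (m n : nat) (N : 'rV[R]_m -> R) (w : R -> R)
    (p : 'I_n -> 'rV[R]_m) (q : 'rV[R]_m) (t : 'I_n -> R) :
  is_norm N ->
  cost N w p q t (star R m n) =
  \sum_i w (t i) * N (p i) + w (\sum_i t i) * N q.
Proof.
move=> hN; rewrite (hub_cost _ _ _ _ _ hN (star_rooted R m n)).
rewrite big_ord0 addr0 sub0r (normN hN).
by under eq_bigr do rewrite subr0.
Qed.

(** * Sufficiency and necessity of the two conditions *)

Section Optimality.
Variables (R : realType) (m n : nat) (N : 'rV[R]_m -> R) (w : R -> R).
Variables (p : 'I_n -> 'rV[R]_m) (q : 'rV[R]_m) (t : 'I_n -> R).
Variables (pstar : 'I_n -> 'rV[R]_m) (qstar : 'rV[R]_m).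
Hypotheses (hN : is_norm N) (hw : weight_function w).
Hypotheses (ht : forall i, 0 < t i).
Hypotheses (hpstar : forall i, is_dual_vector N (p i) (pstar i)).
Hypothesis hqstar : is_dual_vector N q qstar.

Lemma star_minimum :
  \sum_i w (t i) *: pstar i + w (\sum_i t i) *: qstar = 0 ->
  (forall I : {set 'I_n},
     dual_norm N (\sum_(i in I) w (t i) *: pstar i) <= w (\sum_(i in I) t i)) ->
  minimum_arborescence N w p q t (star R m n).
Proof.
move=> balance dual_le; split; first exact: rooted_tree (star_rooted R m n).
move=> G /(@tree_rooted _ _ (sink n _)) [par [depth rG]].
rewrite star_cost// (rooted_cost _ _ _ _ hN rG).
have dual_leN (I : {set 'I_n}) x :
    dot (\sum_(i in I) w (t i) *: pstar i) x <= w (\sum_(i in I) t i) * N x.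
  apply: dual_norm_dot_le (dual_le I) _ x => //.
  (* Each [pstar i] is dominated by [N], so the total weight bounds the set and the supremum is
     genuine. *)
  exists (\sum_(i in I) w (t i)) => _ [x /= Nx <-].
  rewrite dot_suml; apply: ler_sum => i _.
  rewrite dotZl ler_piMr//; first exact/(weight_ge0 hw)/ltW.
  exact: le_trans (dual_vector_dot_le hN (hpstar i) x) Nx.
(* Balance replaces the weighted [qstar] by minus the weighted sum of the [pstar i]. *)
have -> : \sum_i w (t i) * N (p i) + w (\sum_i t i) * N q =
    \sum_i w (t i) * dot (pstar i) (p i - q).
  transitivity (\sum_i w (t i) * dot (pstar i) (p i) +
      dot (w (\sum_i t i) *: qstar) q).
    rewrite dotZl (proj1 hqstar); congr (_ + _).
    by apply: eq_bigr => i _; rewrite (proj1 (hpstar i)).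
  rewrite -(addr0_eq balance) -scaleN1r dotZl mulN1r dot_suml -sumrB.
  by apply: eq_bigr => i _; rewrite dotZl -mulrBr dotDr dotNr.
have pathE i : p i - q =
    \sum_(a | (a != sink n _) && fconnect par (source (nsteiner G) i) a)
      (location p q a - location p q (par a)).
  by rewrite (rooted_telescope rG (location p q (G := G))).
under eq_bigr do rewrite pathE dot_sumr mulr_sumr.
(* For a fixed edge, the sources routed through it form the set [I] to which the dual bound
   applies. *)
rewrite (exchange_big_dep (fun a => a != sink n _))/= => [|i a _ /andP[]//].
apply: ler_sum => a ar.
have setE (F : 'I_n -> R) :
    \sum_(i in [set i | fconnect par (source _ i) a]) F i =
    \sum_(i | fconnect par (source _ i) a) F i.
  by apply: eq_bigl => i; rewrite inE.
rewrite ar -!setE; apply: le_trans (dual_leN _ _).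
by rewrite dot_suml; under [leRHS]eq_bigr do rewrite dotZl.
Qed.

Hypotheses (hsmooth : smooth_norm N) (hp : forall i, p i != 0) (hq : q != 0).
Hypothesis star_min : minimum_arborescence N w p q t (star R m n).

Lemma star_minimum_balance :
  \sum_i w (t i) *: pstar i + w (\sum_i t i) *: qstar = 0.
Proof.
apply: dot_ge0_eq0 => v.
(* Sources and sink share one index type, with [None] for the sink. *)
pose c x := if x is Some i then w (t i) else w (\sum_i t i).
pose pq x := if x is Some i then p i else q.
pose pqstar x := if x is Some i then pstar i else qstar.
have -> : dot (\sum_i w (t i) *: pstar i + w (\sum_i t i) *: qstar) v =
    \sum_x c x * dot (pqstar x) v + 0.
  rewrite sum_option addr0 dotDl dot_suml dotZl addrC; congr (_ + _).
  by apply: eq_bigr => i _; rewrite dotZl.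
apply: (@first_variation_ge0 _ _ _ hN _ c pq) => [[i|]|[i|]|h h0] //=.
- exact: hsmooth.
- exact: hsmooth.
rewrite [X in X + _]sum_option /= mulr0 addr0.
(* Placing the Steiner point at [- (h *: v)] has the effect of translating every terminal by
   [h *: v]. *)
have := proj2 star_min (GilbertGraph (fun=> - (h *: v))
  (hub_adj (fun _ : 'I_n => ord0 : 'I_1))) (rooted_tree (hub_rooted _)).
rewrite star_cost// (hub_cost _ _ _ _ _ hN (hub_rooted _)) big_ord0 addr0.
rewrite -opprD (normN hN) [h *: v + q]addrC.
under [in leRHS]eq_bigr do rewrite opprK.
rewrite -subr_ge0 opprD addrACA -sumrB -mulrBr addrC.
by under [X in _ + X]eq_bigr do rewrite -mulrBr.
Qed.

Lemma star_minimum_dual_norm (I : {set 'I_n}) :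
  dual_norm N (\sum_(i in I) w (t i) *: pstar i) <= w (\sum_(i in I) t i).
Proof.
have wI : 0 <= w (\sum_(i in I) t i).
  by apply: (weight_ge0 hw); apply: sumr_ge0 => i _; exact: ltW.
apply: (dual_norm_le hN) => x Nx.
pose v i := if i \in I then - x else 0.
have -> : dot (\sum_(i in I) w (t i) *: pstar i) x =
    - \sum_i w (t i) * dot (pstar i) (v i).
  rewrite dot_suml -sumrN big_mkcond; apply: eq_bigr => i _.
  rewrite /v; case: ifP => _; last by rewrite dot0r mulr0 oppr0.
  by rewrite dotNr mulrN opprK dotZl.
rewrite lerNl -subr_ge0 opprK.
apply: (@first_variation_ge0 _ _ _ hN _ (w \o t) p) => // [i|h h0].
  exact: hsmooth.
(* Steiner point [ord0] stays at the origin; [ord_max], at [h *: x], collects the sources in [I]. *)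
pose g i : 'I_2 := if i \in I then ord_max else ord0.
pose s (j : 'I_2) := if j == ord0 then 0 else h *: x.
have := proj2 star_min (GilbertGraph s (hub_adj g))
  (rooted_tree (hub_rooted _)).
rewrite star_cost// (hub_cost _ _ _ _ _ hN (hub_rooted _)) big_ord1 /s /=.
rewrite sub0r (normN hN) subr0 (is_norm_scale hN) gtr0_norm//.
(* The edge to the sink carries the full flow in both trees and cancels. *)
rewrite [w _ * N q + _]addrC addrA lerD2r.
rewrite -subr_ge0 addrAC -sumrB => /le_trans; apply; apply: lerD.
  apply: ler_sum => i _; rewrite -mulrBr /= /v /g.
  by case: (i \in I) => /=; rewrite ?scaler0 ?addr0 ?subr0 ?scalerN.
have -> : \sum_(i | g i == lift ord0 ord0) t i = \sum_(i in I) t i.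
  by apply: eq_bigl => i; rewrite /g; case: (i \in I).
(* As [N x <= 1], the new edge costs at most [h] times the weight of the flow from [I]. *)
by rewrite mulrCA ler_pM2l// ler_piMr.
Qed.

End Optimality.

Theorem theorem1 (R : realType) (m n : nat) (N : 'rV[R]_m -> R) (w : R -> R)
    (p : 'I_n -> 'rV[R]_m) (q : 'rV[R]_m) (t : 'I_n -> R)
    (pstar : 'I_n -> 'rV[R]_m) (qstar : 'rV[R]_m)
    (hN : is_norm N) (hsmooth : smooth_norm N)
    (hw : weight_function w) (hconc : concave_weight w)
    (hp : forall i, p i != 0) (hq : q != 0)
    (ht : forall i, 0 < t i)
    (hpstar : forall i, is_dual_vector N (p i) (pstar i))
    (hqstar : is_dual_vector N q qstar) :
  minimum_arborescence N w p q t (star R m n) <->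
  \sum_(i < n) w (t i) *: pstar i + w (\sum_(i < n) t i) *: qstar = 0 /\
  (forall I : {set 'I_n},
     dual_norm N (\sum_(i in I) w (t i) *: pstar i) <= w (\sum_(i in I) t i)).
Proof.
split=> [star_min|[balance dual_le]]; last first.
  exact: (star_minimum hN hw ht hpstar hqstar balance dual_le).
split=> [|I].
  exact: (star_minimum_balance hN hpstar hqstar hsmooth hp hq star_min).
exact: (star_minimum_dual_norm hN hw ht hpstar hsmooth hp star_min I).
Qed.
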